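(* For every $k \in \mathbb{N}$ there exists an effective constant $D_k > 0$ such that for every $\alpha \in \mathbb{R}$ and every $n \in \mathbb{N}$ there exist integers $1 \le b_1, \ldots, b_k \le n$ with $$\left\| \sum_{j=1}^{k} \sqrt{b_j} - \alpha \right\| \le D_k \cdot n^{-\gamma_k},$$ where $$\gamma_k = 2^{\lfloor \log_2 (k+1) \rfloor - 1} - \tfrac{1}{2} \ge \frac{k-1}{4}.$$
   Context: $\mathbb{N} = \{1,2,\ldots\}$. For a real number $x$, $\|x\| := \min_{m \in \mathbb{Z}} |x - m|$ denotes the distance from $x$ to the nearest integer, and $\lfloor x \rfloor$ is the largest integer less than or equal to $x$. The integers $b_1,\dots,b_k$ need not be distinct. ''Effective'' means that the constant can in principle be computed explicitly; $D_k$ depends only on $k$ (not on $\alpha$ or $n$). *)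

(* Defs.v *)
From HB Require Import structures.
From mathcomp Require Import all_boot all_order all_algebra.
From mathcomp Require Import all_classical all_reals all_analysis.

Set Implicit Arguments.
Unset Strict Implicit.
Unset Printing Implicit Defensive.

Import Order.TTheory GRing.Theory Num.Theory.

Local Open Scope classical_set_scope.
Local Open Scope ring_scope.

(* The infimum is a minimum: see dist_int_le and dist_int_attained. *)
Definition dist_int (R : realType) (x : R) : R :=
  inf [set `|x - m%:~R| | m in [set: int]].

Lemma dist_int_le (R : realType) (x : R) (m : int) :
  dist_int x <= `|x - m%:~R|.
Proof.
apply: ge_inf; last by exists m.
by exists 0 => _ [i _ <-].
Qed.

Lemma dist_int_attained (R : realType) (x : R) :
  exists m : int, dist_int x = `|x - m%:~R|.
Proof.
have [m hm] : exists m : int, forall i : int, `|x - m%:~R| <= `|x - i%:~R|.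
  pose f := Num.floor x.
  have f1 : f%:~R <= x by exact: floor_le.
  have f2 : x < (f + 1)%:~R by exact: floorD1_gt.
  have far (i : int) : x - f%:~R <= `|x - i%:~R|
                      \/ (f + 1)%:~R - x <= `|x - i%:~R|.
    have [le_if|lt_fi] := leP i f.
      left; apply: le_trans (ler_norm _).
      by rewrite lerD2l lerN2 ler_int.
    right; rewrite distrC; apply: le_trans (ler_norm _).
    by rewrite lerD2r ler_int lezD1.
  have [h|h] := leP (x - f%:~R) ((f + 1)%:~R - x).
    exists f => i; rewrite ger0_norm ?subr_ge0//.
    by have [//|/(le_trans h)] := far i.
  exists (f + 1) => i; rewrite distrC ger0_norm ?subr_ge0 ?(ltW f2)//.
  by have [/(le_trans (ltW h))|//] := far i.
exists m; apply/eqP; rewrite eq_le dist_int_le /=.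
by apply: lb_le_inf; [exists `|x - m%:~R|, m | move=> _ [i _ <-]].
Qed.

Definition gamma (R : realType) (k : nat) : R :=
  2 ^ (Num.floor (ln k.+1%:R / ln 2 : R) - 1) - 2^-1.

(* Kleene's total recursive functions.  Arguments are passed as a list, and
   missing arguments read as 0, so that no arity has to be tracked.
   Minimization is applied to regular functions only, which is enough to
   obtain all total recursive functions. *)
Inductive recursive : (seq nat -> nat) -> Prop :=
| rec_zero : recursive (fun=> 0%N)
| rec_succ : recursive (fun s => (nth 0 s 0).+1)%N
| rec_proj (i : nat) : recursive (fun s => nth 0 s i)%N
| rec_comp (f : seq nat -> nat) (m : nat) (g : nat -> seq nat -> nat) :
    recursive f -> (forall i, (i < m)%N -> recursive (g i)) ->
    recursive (fun s => f (mkseq (fun i => g i s) m))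
| rec_prim (f g : seq nat -> nat) :
    recursive f -> recursive g ->
    recursive (fun s =>
      nat_rec (fun=> nat) (f (behead s))
        (fun y r => g [:: y, r & behead s]) (nth 0 s 0)%N)
| rec_mu (f : seq nat -> nat)
    (f_regular : forall s, exists y, f (y :: s) == 0%N) :
    recursive f -> recursive (fun s => ex_minn (f_regular s)).

(* D is a computable sequence of nonnegative reals: an algorithm taking k and p
   returns a rational approximation of D k within 1 / (p + 1). *)
Definition effective (R : realType) (D : nat -> R) : Prop :=
  exists2 F : seq nat -> nat, recursive F &
    forall k p : nat,
      `|D k - (F [:: k; p])%:R / p.+1%:R| <= p.+1%:R^-1.

(* Main.v *)
(* The square roots of the 2 ^ m = K + 1 products of m pairwise coprime
   non-squares form a Q-basis of a number field. By the pigeonhole principle some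
   nonzero combination xi of them with integer coefficients O(C) satisfies
   |xi| <= C ^ - K. The products of xi with the basis elements are equally small,
   also have coefficients O(C), and are linearly independent over Q, so they span
   a full lattice in the coordinate space; rounding a real point whose coordinates
   are large multiples of C and whose value is alpha to this lattice yields
   positive integers c_i = O(C) with sum_i c_i sqrt d_i within O(C ^ - K) of alpha
   modulo 1. Finally c_i sqrt d_i = sqrt (c_i ^ 2 d_i), and C is of order sqrt n. *)
Require Import Defs.
From HB Require Import structures.
From mathcomp Require Import all_boot all_order all_algebra.
From mathcomp Require Import all_classical all_reals all_analysis.
Import Order.TTheory GRing.Theory Num.Theory.
From mathcomp Require Import ring lra zify.
Local Open Scope ring_scope.

(** * Closure properties of recursive functions *)

Lemma recursive_comp1 (f : nat -> nat) (g : seq nat -> nat) :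
  recursive (fun s => f (nth 0 s 0)%N) -> recursive g ->
  recursive (fun s => f (g s)).
Proof. by move=> rf rg; apply: (rec_comp (m := 1) (g := fun=> g) rf). Qed.

Lemma recursive_comp2 (f : nat -> nat -> nat) (g h : seq nat -> nat) :
  recursive (fun s => f (nth 0 s 0)%N (nth 0 s 1)%N) ->
  recursive g -> recursive h -> recursive (fun s => f (g s) (h s)).
Proof.
move=> rf rg rh.
apply: (rec_comp (m := 2) (g := fun i => if i is 0%N then g else h) rf).
by case.
Qed.

Lemma recursive_const (c : nat) : recursive (fun=> c).
Proof.
elim: c => [|c rc]; first exact: rec_zero.
exact: (recursive_comp1 S _ rec_succ rc).
Qed.

Lemma recursive_add (f g : seq nat -> nat) :
  recursive f -> recursive g -> recursive (fun s => f s + g s)%N.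
Proof.
apply: recursive_comp2.
have := rec_prim (rec_proj 0) (recursive_comp1 S _ rec_succ (rec_proj 1)).
congr recursive; apply/funext => s.
by rewrite /= nth_behead; elim: (nth 0 s 0)%N => //= n ->.
Qed.

Lemma recursive_mul (f g : seq nat -> nat) :
  recursive f -> recursive g -> recursive (fun s => f s * g s)%N.
Proof.
apply: recursive_comp2.
have := rec_prim rec_zero (recursive_add _ _ (rec_proj 2) (rec_proj 1)).
congr recursive; apply/funext => s /=.
elim: (nth 0 s 0)%N => //= n ->.
by rewrite nth_behead mulSn.
Qed.

(** The exponent comes first because primitive recursion runs on the first argument. *)
Lemma recursive_exp (f g : seq nat -> nat) :
  recursive f -> recursive g -> recursive (fun s => g s ^ f s)%N.
Proof.
apply: (recursive_comp2 (fun a b => (b ^ a)%N)).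
have := rec_prim (recursive_const 1)
  (recursive_mul _ _ (rec_proj 2) (rec_proj 1)).
congr recursive; apply/funext => s /=.
elim: (nth 0 s 0)%N => //= n ->.
by rewrite nth_behead expnS.
Qed.

Lemma effective_natr (R : realType) (D : nat -> nat) :
  recursive (fun s => D (nth 0 s 0))%N -> effective (fun k => (D k)%:R : R).
Proof.
(* The fraction [D k * (p + 1) / (p + 1)] is exact, so the error is 0. *)
move=> rD; exists (fun s => D (nth 0 s 0) * (nth 0 s 1).+1)%N.
  by apply: recursive_mul _ _ rD (recursive_comp1 S _ rec_succ (rec_proj 1)).
by move=> k p; rewrite /= natrM mulfK ?pnatr_eq0// subrr normr0 invr_ge0.
Qed.

(** * Square roots outside multiquadratic fields *)

(** In [q * denq x ^ 2 = numq x ^ 2] the exponent of [r] is odd on the left and even on the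
    right. *)
Lemma sqrt_natr_rat (R : realType) (q r : nat) (x : rat) :
  prime r -> odd (logn r q) -> Num.sqrt q%:R <> ratr x :> R.
Proof.
move=> pr oq /(congr1 (fun y => y ^+ 2)).
rewrite sqr_sqrtr// -rmorphXn/= -(ratr_nat R) => /fmorph_inj.
move=> e; have : q%:R * (denq x)%:~R ^+ 2 = (numq x)%:~R ^+ 2 :> rat.
  by rewrite e -{1}(divq_num_den x) expr_div_n divfK// expf_neq0// intr_eq0
    denq_eq0.
rewrite !expr2 -[q%:R]/(q%:Z%:~R) -!intrM => /intr_inj/(congr1 absz).
rewrite !abszM => e2.
have q0 : (0 < q)%N by case: (q) oq; rewrite // logn0.
have d0 : (0 < `|denq x|)%N by rewrite absz_gt0 denq_eq0.
have n0 : (0 < `|numq x|)%N.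
  by rewrite -[(0 < _)%N]andbb -muln_gt0 -e2 !muln_gt0 q0 d0.
move: oq; have := congr1 (odd \o logn r) e2.
by rewrite /= lognM ?muln_gt0 ?d0// !lognM// !oddD !addbb addbF => ->.
Qed.

(* Fermat numbers are pairwise coprime non-squares whose products have a closed
   form, which keeps the final constant an explicit power of 2. *)
Definition fermat (m : nat) : nat := (2 ^ 2 ^ m).+1.

Fixpoint fermat_prod (m : nat) : nat :=
  if m is m'.+1 then (fermat_prod m' * fermat m')%N else 1%N.

(** Telescoping by (X - 1)(X + 1) = X^2 - 1. It yields both coprimality and the size bound on the
    radicands. *)
Lemma fermat_prodE (m : nat) : (fermat_prod m).+1 = (2 ^ 2 ^ m)%N.
Proof.
elim: m => //= m IHm; rewrite /fermat.
have -> : (2 ^ 2 ^ m.+1 = (2 ^ 2 ^ m) * 2 ^ 2 ^ m)%N.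
  by rewrite -expnD addnn -mul2n -expnS.
by rewrite -IHm; ring.
Qed.

(** For m > 0, F_m = X^2 + 1 with X = 2^2^(m-1) lies strictly between consecutive squares, and F_0 =
    3; so some prime r has odd exponent in F_m. If r divided the product of the earlier Fermat
    numbers, which is F_m - 2, it would be 2, but F_m is odd. *)
Lemma fermat_odd_prime (m : nat) :
  exists r, [/\ prime r, ~~ (r %| fermat_prod m)%N & odd (logn r (fermat m))].
Proof.
have /hasP[r rp ro] :
    has (fun r => odd (logn r (fermat m))) (primes (fermat m)).
  apply/negPn/negP => nh.
  have evn r : ~~ odd (logn r (fermat m)).
    apply/negP => o; move/negP: nh; apply; apply/hasP; exists r => //.
    by rewrite -logn_gt0; case: logn o.
  pose a := (\prod_(p <- primes (fermat m)) p ^ (logn p (fermat m))./2)%N.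
  have aE : (a ^ 2)%N = fermat m.
    rewrite [RHS]prod_prime_decomp// prime_decompE big_map /= /a.
    rewrite -[(_ ^ 2)%N]/(_ * _)%N -big_split /=; apply: eq_bigr => p _.
    by rewrite -expnD addnn even_halfK.
  have [m0|m0] := posnP m.
    by move: aE; rewrite m0 -[fermat 0]/3%N -mulnn; case: (a) => [|[|b]]//;
      rewrite !mulSn; lia.
  have h : (2 ^ 2 ^ m)%N = ((2 ^ 2 ^ m.-1) ^ 2)%N.
    by rewrite -expnM -expnSr prednK.
  have X0 : (0 < 2 ^ 2 ^ m.-1)%N by rewrite expn_gt0.
  move: aE X0; rewrite /fermat {}h; move: (2 ^ 2 ^ m.-1)%N => X aE X0.
  have : (X < a < X.+1)%N.
    apply/andP; split; rewrite -(@ltn_exp2r _ _ 2)// aE// -!mulnn; lia.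
  by rewrite ltnS ltnNge; case: leqP.
have rf : (r %| fermat m)%N by move: rp; rewrite mem_primes => /and3P[].
exists r; split => //; first by move: rp; rewrite mem_primes => /andP[].
apply/negP => rq.
have r2 : (r %| 2)%N.
  by rewrite -(@dvdn_addr (fermat_prod m))// addn2 fermat_prodE.
have := r2; rewrite dvdn_prime2// => [/eqP r2E|]; last first.
  by move: rp; rewrite mem_primes => /andP[].
by move: rf; rewrite r2E /fermat dvdn2 /= oddX expn_eq0.
Qed.

(* Membership in the field generated over Q by the square roots of the first [m]
   Fermat numbers. *)
Fixpoint multiquad (R : realType) (m : nat) (x : R) : Prop :=
  if m is m'.+1 then
    exists a b, [/\ multiquad R m' a, multiquad R m' b &
                    x = a + b * Num.sqrt (fermat m')%:R]
  else exists r : rat, x = ratr r.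

Section Multiquad.
Variable R : realType.
Implicit Types (m : nat) (x y a b : R).
Local Notation F := (@multiquad R).
Local Notation sq m := (Num.sqrt (fermat m)%:R : R).

Lemma multiquad_rat m : forall r : rat, F m (ratr r).
Proof.
elim: m => [|m IHm] r /=; first by exists r.
by exists (ratr r), (ratr 0); split; rewrite // rmorph0 mul0r addr0.
Qed.

Lemma multiquad0 m : F m 0.
Proof. by rewrite -(rmorph0 (@ratr R)); apply: multiquad_rat. Qed.

Lemma multiquadS m x : F m x -> F m.+1 x.
Proof.
by move=> Fx; exists x, 0; split=> //; [exact: multiquad0|rewrite mul0r addr0].
Qed.

Lemma multiquad_add m : forall x y, F m x -> F m y -> F m (x + y).
Proof.
elim: m => [|m IHm] x y /=.
  by move=> [r ->] [s ->]; exists (r + s); rewrite rmorphD.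
move=> [a [b [Fa Fb ->]]] [c [d [Fc Fd ->]]].
by exists (a + c), (b + d); split; [exact: IHm|exact: IHm|ring].
Qed.

Lemma multiquad_mul m : forall x y, F m x -> F m y -> F m (x * y).
Proof.
elim: m => [|m IHm] x y /=.
  by move=> [r ->] [s ->]; exists (r * s); rewrite rmorphM.
move=> [a [b [Fa Fb ->]]] [c [d [Fc Fd ->]]].
exists (a * c + ratr (fermat m)%:R * (b * d)), (a * d + b * c); split.
- apply: multiquad_add; first exact: IHm.
  by apply/IHm/IHm => //; exact: multiquad_rat.
- by apply: multiquad_add; apply: IHm.
set s := sq m; have <- : s ^+ 2 = ratr (fermat m)%:R.
  by rewrite ratr_nat sqr_sqrtr.
by ring.
Qed.

Lemma multiquad_opp m x : F m x -> F m (- x).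
Proof.
by move=> Fx; rewrite -mulN1r -(rmorphN1 (@ratr R));
  apply: multiquad_mul => //; apply: multiquad_rat.
Qed.

(** Multiply by the conjugate [a - b * s]. If it vanishes, then s = a / b lies in the smaller field,
    and the element with it. *)
Lemma multiquad_inv m : forall x, F m x -> F m x^-1.
Proof.
elim: m => [|m IHm] x /=; first by move=> [r ->]; exists r^-1; rewrite fmorphV.
move=> [a [b [Fa Fb ->]]].
have [->|b0] := eqVneq b 0; first by rewrite mul0r addr0; apply/multiquadS/IHm.
set s := sq m.
have s2 : s ^+ 2 = ratr (fermat m)%:R by rewrite ratr_nat sqr_sqrtr.
have [e|n0] := eqVneq (a - b * s) 0.
  have sE : s = a / b.
    by rewrite -(subrK (b * s) a) e add0r mulrAC divff// mul1r.
  apply/multiquadS/IHm; rewrite -/s sE.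
  by apply: multiquad_add => //; do 2![apply: multiquad_mul => //]; exact: IHm.
have [e'|n0'] := eqVneq (a + b * s) 0.
  by rewrite e' invr0; apply: (multiquad0 m.+1).
pose N := a * a + - (ratr (fermat m)%:R * (b * b)).
have NE : N = (a + b * s) * (a - b * s) by rewrite /N -s2; ring.
have FN : F m N^-1.
  apply: IHm; apply: multiquad_add; first exact: multiquad_mul.
  by apply/multiquad_opp/multiquad_mul/multiquad_mul => //;
    apply: multiquad_rat.
exists (a * N^-1), (- b * N^-1); split.
- exact: multiquad_mul.
- by apply: multiquad_mul => //; apply: multiquad_opp.
by rewrite NE -/s; field; rewrite n0 n0'.
Qed.

(** Induction with q varying. Let sqrt q = a + b sqrt F_m. If b = 0, sqrt q lies in the smaller
    field; if a = 0, sqrt (q F_m) does, and r still has odd exponent; otherwise squaring puts sqrt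
    F_m there, against the induction hypothesis for an odd-exponent prime of F_m. *)
Lemma sqrt_notin_multiquad m : forall q r,
  prime r -> ~~ (r %| fermat_prod m)%N -> odd (logn r q) -> ~ F m (Num.sqrt q%:R).
Proof.
elim: m => [|m IHm] q r pr rm oq.
  by move=> [x]; apply: (sqrt_natr_rat _ _ r).
have [rm1 rm2] : ~~ (r %| fermat_prod m)%N /\ ~~ (r %| fermat m)%N.
  by apply/andP; rewrite -negb_or -Euclid_dvdM.
move=> [a [b [Fa Fb e]]].
have [b0|b0] := eqVneq b 0.
  by apply: (IHm q r) => //; rewrite e b0 mul0r addr0.
have [a0|a0] := eqVneq a 0.
  apply: (IHm (q * fermat m)%N r) => //.
    have q0 : (0 < q)%N by case: (q) oq; rewrite // logn0.
    by rewrite lognM// oddD oq (@logn_coprime r (fermat m))// prime_coprime.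
  rewrite natrM sqrtrM// e a0 add0r -mulrA -expr2 sqr_sqrtr// -(ratr_nat R).
  by apply: multiquad_mul => //; apply: multiquad_rat.
have [r' [pr' r'm or']] := fermat_odd_prime m.
apply: (IHm (fermat m) r') => //.
have s2 := sqr_sqrtr (ler0n R (fermat m)).
have q2 := sqr_sqrtr (ler0n R q).
have -> : sq m = (ratr q%:R + - (a * a + ratr (fermat m)%:R * (b * b))) *
   (ratr 2 * a * b)^-1.
  rewrite !ratr_nat -q2 e -[in X in _ - (_ + X * _)]s2; field.
  by rewrite a0 b0.
have Fr (x : rat) : F m (ratr x) by exact: multiquad_rat.
apply: multiquad_mul; last first.
  by apply/multiquad_inv/multiquad_mul => //; apply: multiquad_mul.
apply/multiquad_add => //; apply/multiquad_opp/multiquad_add.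
  exact: multiquad_mul.
by apply: multiquad_mul => //; apply: multiquad_mul.
Qed.

End Multiquad.

(** * Products of distinct Fermat numbers and their square roots *)

Fixpoint radicands (m : nat) : seq nat :=
  if m is m'.+1 then radicands m' ++ [seq (fermat m' * d)%N | d <- radicands m']
  else [:: 1%N].

Lemma size_radicands m : size (radicands m) = (2 ^ m)%N.
Proof.
elim: m => //= m IHm.
by rewrite size_cat size_map IHm addnn -mul2n -expnS.
Qed.

Lemma radicands_bounds m d : d \in radicands m -> (0 < d <= fermat_prod m)%N.
Proof.
elim: m d => [|m IHm] d /=; first by rewrite inE => /eqP ->.
rewrite mem_cat => /orP[/IHm/andP[-> h]|/mapP[e /IHm/andP[e0 eb] ->]].
  by rewrite (leq_trans h)// leq_pmulr.
by rewrite muln_gt0 e0 /= mulnC leq_mul2r eb orbT.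
Qed.

(** The Fermat numbers common to x and y are collected in g, the others in z. Hence products of the
    square roots are integer multiples of such roots. *)
Lemma radicands_mul m x y : x \in radicands m -> y \in radicands m ->
  exists z g : nat, z \in radicands m /\ (x * y = g ^ 2 * z)%N.
Proof.
elim: m x y => [|m IHm] x y /=.
  by rewrite !inE => /eqP -> /eqP ->; exists 1%N, 1%N; rewrite inE.
rewrite !mem_cat => /orP[hx|/mapP[x' hx ->]] /orP[hy|/mapP[y' hy ->]].
- have [z [g [hz e]]] := IHm _ _ hx hy.
  by exists z, g; rewrite mem_cat hz.
- have [z [g [hz e]]] := IHm _ _ hx hy.
  exists (fermat m * z)%N, g; rewrite mem_cat map_f ?orbT//; split => //.
  by rewrite mulnCA e mulnCA.
- have [z [g [hz e]]] := IHm _ _ hx hy.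
  exists (fermat m * z)%N, g; rewrite mem_cat map_f ?orbT//; split => //.
  by rewrite -mulnA e mulnCA.
- have [z [g [hz e]]] := IHm _ _ hx hy.
  exists z, (g * fermat m)%N; rewrite mem_cat hz; split => //.
  by rewrite mulnACA e expnMn; ring.
Qed.

(** Brings a combination into the shape A + B s of [multiquad], for induction on m. *)
Lemma sum_sqrt_radicandsS (R : realType) m (c : nat -> R) :
  \sum_(i < 2 ^ m.+1) c i * Num.sqrt (nth 0 (radicands m.+1) i)%N%:R =
  \sum_(i < 2 ^ m) c i * Num.sqrt (nth 0 (radicands m) i)%N%:R +
  (\sum_(i < 2 ^ m) c (2 ^ m + i)%N * Num.sqrt (nth 0 (radicands m) i)%N%:R) *
    Num.sqrt (fermat m)%:R.
Proof.
rewrite -(big_mkord xpredT (fun i =>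
  c i * Num.sqrt (nth 0 (radicands m.+1) i)%N%:R)).
rewrite expnS mul2n -addnn big_mkord big_split_ord/=; congr (_ + _).
  by apply: eq_bigr => i _; rewrite nth_cat size_radicands ltn_ord.
rewrite mulr_suml; apply: eq_bigr => i _.
rewrite nth_cat size_radicands ltnNge leq_addr/= addKn (nth_map 0%N)
  ?size_radicands//.
by rewrite natrM sqrtrM// [X in _ * X]mulrC mulrA.
Qed.

Lemma multiquad_sum (R : realType) m (c : nat -> rat) :
  multiquad R m
    (\sum_(i < 2 ^ m) ratr (c i) * Num.sqrt (nth 0 (radicands m) i)%N%:R).
Proof.
elim: m c => [|m IHm] c.
  by exists (c 0%N); rewrite big_ord1 /= sqrtr1 mulr1.
rewrite (sum_sqrt_radicandsS _ _ (fun i => ratr (c i))).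
eexists; eexists; split; [exact: IHm | | by []].
exact: (IHm (fun i => c (2 ^ m + i)%N)).
Qed.

(** If B were nonzero in A + B sqrt F_m = 0, then sqrt F_m = - A / B would lie in the smaller field.
    So A = B = 0, and induction applies to both halves. *)
Lemma sqrt_radicands_free (R : realType) m (c : nat -> rat) :
  \sum_(i < 2 ^ m) ratr (c i) * Num.sqrt (nth 0 (radicands m) i)%N%:R
    = 0 :> R ->
  forall i, (i < 2 ^ m)%N -> c i = 0.
Proof.
elim: m c => [|m IHm] c.
  rewrite big_ord1 /= sqrtr1 mulr1 => /eqP; rewrite fmorph_eq0 => /eqP c0 i.
  by rewrite ltnS leqn0 => /eqP ->.
rewrite (sum_sqrt_radicandsS _ _ (fun i => ratr (c i))).
set A := \sum_(_ < _) _; set B := \sum_(_ < _) _ => e.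
have B0 : B = 0.
  apply/eqP/negPn/negP => B0.
  have [r [pr rm ro]] := fermat_odd_prime m.
  apply: (sqrt_notin_multiquad R m (fermat m) r) => //.
  have -> : Num.sqrt (fermat m)%:R = - A * B^-1 :> R.
    by apply: (mulfI B0); rewrite mulrCA divff// mulr1; apply/eqP;
      rewrite -addr_eq0 addrC e.
  apply: multiquad_mul; first exact/multiquad_opp/multiquad_sum.
  exact/multiquad_inv/(multiquad_sum R m (fun i => c (2 ^ m + i)%N)).
have A0 : A = 0 by move: e; rewrite B0 mul0r addr0.
move=> i; have [im _|mi ib] := ltnP i (2 ^ m); first exact: IHm A0 _ im.
have := IHm (fun i => c (2 ^ m + i)%N) B0 (i - 2 ^ m)%N.
rewrite subnKC//; apply.
by rewrite ltn_subLR// addnn -mul2n -expnS.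
Qed.

(** * Pigeonhole principle and lattice rounding *)

(** There are (C + 1)^K vectors with entries in 0..C but only C^K intervals of length C^-K in [0,
    1), so the fractional parts of two sums share an interval; the difference of the two vectors
    works. *)
Lemma dirichlet (R : realType) (K C : nat) (theta : 'I_K -> R) :
  (0 < K)%N -> (0 < C)%N ->
  exists (c0 : int) (c : 'I_K -> int),
    [/\ exists i, c i != 0, forall i, `|c i| <= C%:Z &
        `|c0%:~R + \sum_i (c i)%:~R * theta i| <= (C%:R ^+ K)^-1].
Proof.
move=> K0 C0.
pose S (f : {ffun 'I_K -> 'I_C.+1}) : R := \sum_i (f i)%:R * theta i.
pose fl f := Num.floor (S f).
pose u f : R := (S f - (fl f)%:~R) * (C ^ K)%:R.
pose h f : nat := `|Num.floor (u f)|%N.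
have CK0 : 0 < (C ^ K)%:R :> R by rewrite ltr0n expn_gt0 C0.
have fr1 f : S f - (fl f)%:~R < 1.
  by rewrite ltrBlDl; have := floorD1_gt (S f); rewrite intrD.
have hE f : Num.floor (u f) = h f.
  by rewrite /h gez0_abs// floor_ge0 mulr_ge0 ?(ltW CK0)// subr_ge0 floor_le.
have hlt f : (h f < C ^ K)%N.
  rewrite -(ltr_nat R) -[_%:R]/(_%:Z%:~R) -hE;
    apply: le_lt_trans (floor_le _) _.
  by rewrite gtr_pMl.
pose H f := Ordinal (hlt f).
have [/injectiveP/leq_card|/injectivePn[f [g fg]]] := boolP (injectiveb H).
  rewrite card_ffun !card_ord => le; exfalso; move: le.
  by apply/negP; rewrite -ltnNge ltn_exp2r.
move=> /(congr1 val)/= hfg.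
exists (fl g - fl f), (fun i => (f i)%:Z - (g i)%:Z); split.
- have [i fgi] : exists i, f i != g i.
    apply/existsP; move: fg; apply: contraNT;
      rewrite negb_exists => /forallP h1.
    by apply/eqP/ffunP => i; apply/eqP; have := h1 i; rewrite negbK.
  by exists i; rewrite subr_eq0 eqz_nat.
- move=> i; rewrite ler_norml; apply/andP; split.
    by rewrite lerNl opprB lerBlDr ler_wpDr// lez_nat -ltnS.
  by rewrite lerBlDr ler_wpDr// lez_nat -ltnS.
have -> : (fl g - fl f)%:~R + \sum_i ((f i)%:Z - (g i)%:Z)%:~R * theta i
  = (S f - (fl f)%:~R) - (S g - (fl g)%:~R).
  under eq_bigr do rewrite intrB mulrBl.
  by rewrite sumrB intrB -/(S f) -/(S g); ring.
rewrite -natrX -[leRHS]mul1r ler_pdivlMr// -[X in _ * X](gtr0_norm CK0).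
rewrite -normrM mulrBl ler_norml -/(u f) -/(u g).
have := floor_le (u f); have := floorD1_gt (u f).
have := floor_le (u g); have := floorD1_gt (u g).
by rewrite !hE hfg !intrD; lra.
Qed.

(** Write x = t V and round each t_i down: the error is the combination of the rows of V with the
    fractional parts as coefficients, which bounds its coordinates and its value alike. *)
Lemma lattice_round (R : realType) (n : nat) (V : 'M[int]_n) (theta : 'I_n -> R)
    (B eps : R) (x : 'I_n -> R) :
  \det V != 0 -> (forall i j, `|(V i j)%:~R| <= B) ->
  (forall i, `|\sum_j (V i j)%:~R * theta j| <= eps) ->
  exists z : 'I_n -> int,
    (forall j, `|x j - (z j)%:~R| <= n%:R * B) /\
    `|\sum_j (x j - (z j)%:~R) * theta j| <= n%:R * eps.
Proof.
move=> dV hB heps.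
pose W : 'M[R]_n := map_mx intr V.
have Wu : W \in unitmx by rewrite unitmxE det_map_mx unitfE intr_eq0.
pose t : 'rV[R]_n := (\row_j x j) *m invmx W.
have xE j : x j = \sum_i t 0 i * (V i j)%:~R.
  have := congr1 (fun A : 'rV_n => A 0 j) (mulmxKV Wu (\row_j x j)).
  rewrite [RHS]mxE mxE => <-; apply: eq_bigr => i _.
  by rewrite [W _ _]mxE.
pose f i : R := t 0 i - (Num.floor (t 0 i))%:~R.
have f01 i : `|f i| <= 1.
  have := floor_le (t 0 i); have := floorD1_gt (t 0 i).
  by rewrite intrD /f ler_norml; lra.
pose z j : int := \sum_i Num.floor (t 0 i) * V i j.
have zE j : x j - (z j)%:~R = \sum_i f i * (V i j)%:~R.
  rewrite xE rmorph_sum/= -sumrB; apply: eq_bigr => i _.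
  by rewrite intrM -mulrBl.
have bnd (g : 'I_n -> R) (b : R) : (forall i, `|g i| <= b) ->
    `|\sum_i f i * g i| <= n%:R * b.
  move=> hg; apply: le_trans (ler_norm_sum _ _ _) _.
  have -> : n%:R * b = \sum_(i < n) b by rewrite sumr_const card_ord mulr_natl.
  apply: ler_sum => i _; rewrite normrM -[b]mul1r.
  exact: ler_pM.
exists z; split=> [j|]; first by rewrite zE; apply: bnd.
have -> : \sum_j (x j - (z j)%:~R) * theta j =
          \sum_i f i * \sum_j (V i j)%:~R * theta j.
  under eq_bigr do rewrite zE mulr_suml.
  rewrite exchange_big/=; apply: eq_bigr => i _; rewrite mulr_sumr.
  by apply: eq_bigr => j _; rewrite mulrA.
exact: bnd.
Qed.

(** * Approximation by square roots from a basis *)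

Lemma sqrt_basis_approx (R : realType) (K M C : nat)
    (d : 'I_K.+1 -> nat) (alpha : R) :
  (0 < K)%N -> (0 < C)%N -> d ord0 = 1%N ->
  (forall i, (0 < d i <= M)%N) ->
  (forall i j, exists l g, (d i * d j = g ^ 2 * d l)%N) ->
  (forall c : 'I_K.+1 -> rat, \sum_i ratr (c i) * Num.sqrt (d i)%:R = 0 :> R ->
     forall i, c i = 0) ->
  exists b : 'I_K -> nat,
    (forall i, 1 <= b i <= 9 * K.+1 ^ 6 * M ^ 5 * C ^ 2)%N /\
    dist_int (\sum_i Num.sqrt (b i)%:R - alpha) <= (K.+1 * M)%:R / C%:R ^+ K.
Proof.
move=> K0 C0 d0 dM dmul dfree.
pose th i : R := Num.sqrt (d i)%:R.
have th0 : th ord0 = 1 by rewrite /th d0 sqrtr1.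
have d1 i : (0 < d i)%N by case/andP: (dM i).
have thge0 i : 0 <= th i by exact: sqrtr_ge0.
have thM i : th i <= M%:R.
  rewrite /th -(ler_pXn2r (n := 2))// ?nnegrE ?sqrtr_ge0// sqr_sqrtr//.
  rewrite -natrX ler_nat; case/andP: (dM i) => d0i dMi.
  by rewrite (leq_trans dMi)// -[X in (X <= _)%N]expn1 leq_pexp2l//
    (leq_trans d0i).
have M0 : (0 < M)%N by case/andP: (dM ord0) => /leq_trans; apply.
have [c0 [c' [[i0 ci0] c'C small]]] :=
  dirichlet R K C (fun i => th (lift ord0 i)) K0 C0.
pose c (i : 'I_K.+1) : int := if unlift ord0 i is Some j then c' j else c0.
have cl j : c (lift ord0 j) = c' j by rewrite /c liftK.
have c00 : c ord0 = c0 by rewrite /c unlift_none.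
pose xi : R := \sum_i (c i)%:~R * th i.
have xiE : xi = c0%:~R + \sum_i (c' i)%:~R * th (lift ord0 i).
  rewrite /xi big_ord_recl c00 th0 mulr1; congr (_ + _).
  by apply: eq_bigr => i _; rewrite cl.
have CK1 : (C%:R ^+ K)^-1 <= 1 :> R.
  by rewrite invf_le1 ?exprn_gt0 ?ltr0n// exprn_ege1// ler1n.
have xis : `|xi| <= (C%:R ^+ K)^-1 by rewrite xiE.
have xin0 : xi != 0.
  apply/eqP => e; move: ci0; rewrite -cl.
  suff -> : c (lift ord0 i0) = 0 by rewrite eqxx.
  apply/eqP; rewrite -(intr_eq0 rat); apply/eqP.
  apply: (dfree (fun i => (c i)%:~R)); rewrite -[RHS]e.
  by apply: eq_bigr => i _; rewrite ratr_int.
have cB i : `|(c i)%:~R| <= (K.+1 * C * M)%:R :> R.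
  have c'R j : `|(c' j)%:~R| <= C%:R :> R.
    by rewrite -intr_norm -[C%:R]/(C%:Z%:~R) ler_int.
  case: (unliftP ord0 i) => [j ->|->].
    rewrite cl; apply: le_trans (c'R j) _.
    by rewrite ler_nat mulnAC leq_pmull// muln_gt0.
  (* The pigeonhole argument does not bound [c0] itself; solving for it in [xi] gives |c0| <= 1 + K
     C M. *)
  rewrite c00.
  have -> : c0%:~R = xi - \sum_i (c' i)%:~R * th (lift ord0 i).
    by rewrite xiE addrK.
  apply: le_trans (ler_normB _ _) _.
  rewrite mulSn mulnDl natrD; apply: lerD.
    by rewrite (le_trans xis)// (le_trans CK1)// ler1n muln_gt0 C0.
  apply: le_trans (ler_norm_sum _ _ _) _.
  have -> : (K * C * M)%:R = \sum_(i < K) (C%:R * M%:R) :> R.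
    by rewrite sumr_const card_ord -[RHS]mulr_natl -!natrM mulnA.
  by apply: ler_sum => j _; rewrite normrM (ger0_norm (thge0 _)) ler_pM.
have [l hl] := choice (fun p : 'I_K.+1 * 'I_K.+1 => dmul p.1 p.2).
have [g hg] := choice hl.
(* g^2 <= g^2 d_l = d_i d_j <= M^2. *)
have gM p : (g p <= M)%N.
  rewrite -(@leq_exp2r _ _ 2)//; apply: (@leq_trans (g p ^ 2 * d (l p))%N).
    by rewrite leq_pmulr.
  rewrite -hg -mulnn; apply: leq_mul;
    [case/andP: (dM p.1)|case/andP: (dM p.2)] => //.
have thmul i j : th i * th j = (g (i, j))%:R * th (l (i, j)).
  rewrite /th -sqrtrM// -natrM (hg (i, j)) natrM sqrtrM// natrX sqrtr_sqr.
  by rewrite ger0_norm.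
(* Row j holds the coordinates of [xi * th j]: this is the matrix of multiplication by [xi], with
   entries still O(C). *)
pose V : 'M[int]_K.+1 :=
  \matrix_(j, k) \sum_(i | l (i, j) == k) c i * (g (i, j))%:Z.
have VE j : \sum_k (V j k)%:~R * th k = xi * th j.
  rewrite /xi mulr_suml [RHS](partition_big (fun i => l (i, j)) xpredT)//=.
  apply: eq_bigr => k _; rewrite mxE rmorph_sum/= mulr_suml.
  apply: eq_bigr => i /eqP <-.
  by rewrite intrM -!mulrA thmul.
(* A relation between the rows of [V] is one between the reals [xi * th i]. *)
have Vdet : \det V != 0.
  rewrite -(intr_eq0 rat) -[_%:~R]/(intr _) -det_map_mx.
  apply/negP => /det0P[v vn0 /rowP vV].
  suff v0 : v = 0 by rewrite v0 eqxx in vn0.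
  apply/rowP => j; rewrite [RHS]mxE; apply: (dfree (fun j => v 0 j)).
  apply: (mulfI xin0); rewrite mulr0 mulr_sumr.
  under eq_bigr => i _ do rewrite mulrCA -/(th i) -VE mulr_sumr.
  rewrite exchange_big/= big1// => k _.
  have vVk : \sum_i v 0 i * (V i k)%:~R = 0.
    have := vV k; rewrite mxE [RHS]mxE => e; rewrite -[RHS]e.
    by apply: eq_bigr => i _; rewrite [map_mx _ _ _ _]mxE.
  transitivity (ratr (\sum_i v 0 i * (V i k)%:~R) * th k).
    rewrite rmorph_sum/= mulr_suml; apply: eq_bigr => i _.
    by rewrite rmorphM/= ratr_int mulrA.
  by rewrite vVk rmorph0 mul0r.
have VB i j : `|(V i j)%:~R| <= (K.+1 ^ 2 * M ^ 2 * C)%:R :> R.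
  rewrite mxE rmorph_sum/=; apply: le_trans (ler_norm_sum _ _ _) _.
  have -> : (K.+1 ^ 2 * M ^ 2 * C)%:R =
      \sum_(i < K.+1) ((K.+1 * C * M)%:R * M%:R) :> R.
    by rewrite sumr_const card_ord -[RHS]mulr_natl -!natrM; congr (_%:R); ring.
  rewrite big_mkcond/=; apply: ler_sum => k _; case: ifP => _;
    last by rewrite -natrM.
  by rewrite intrM normrM ler_pM// normr_nat ler_nat.
have Ve j : `|\sum_k (V j k)%:~R * th k| <= M%:R / C%:R ^+ K.
  by rewrite VE normrM mulrC (ger0_norm (thge0 _)) ler_pM.
(* Rounding moves coordinates by at most [E], so starting from [2 * E] keeps
   them positive; coordinate [0] belongs to [sqrt 1] and may have any sign. *)
pose E := (K.+1 * (K.+1 ^ 2 * M ^ 2 * C))%N.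
pose x (i : 'I_K.+1) : R := if unlift ord0 i is Some _ then (2 * E)%:R else
  alpha - \sum_(i < K) (2 * E)%:R * th (lift ord0 i).
have [z [zx zth]] := lattice_round R _ V th _ _ x Vdet VB Ve.
have xE : \sum_i x i * th i = alpha.
  rewrite big_ord_recl th0 mulr1 /x unlift_none.
  by under [X in _ + X]eq_bigr do rewrite liftK; rewrite subrK.
have zb j : (E%:Z <= z (lift ord0 j)) /\ (z (lift ord0 j) <= (3 * E)%:Z).
  have := zx (lift ord0 j); rewrite /x liftK -natrM -/E ler_norml =>
    /andP[h1 h2].
  rewrite -!(ler_int R) -![_%:Z%:~R]/(_%:R); move: h1 h2; rewrite !natrM;
    split; lra.
exists (fun j => `|z (lift ord0 j)| ^ 2 * d (lift ord0 j))%N.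
have E0 : (0 < E)%N by rewrite /E !muln_gt0 M0 C0.
split.
  move=> j; have [z1 z2] := zb j; apply/andP; split.
    by rewrite muln_gt0 d1 expn_gt0 absz_gt0 gt_eqF// (lt_le_trans _ z1).
  have zE : (`|z (lift ord0 j)| <= 3 * E)%N by lia.
  have -> : (9 * K.+1 ^ 6 * M ^ 5 * C ^ 2 = (3 * E) ^ 2 * M)%N.
    by rewrite /E; ring.
  by apply: leq_mul; rewrite ?leq_exp2r//; case/andP: (dM (lift ord0 j)).
(* Since [th ord0] is 1, the coordinate [z ord0] is an integer shift and disappears modulo 1. *)
apply: le_trans (dist_int_le _ (- z ord0)) _.
have -> :
    \sum_i Num.sqrt (`|z (lift ord0 i)| ^ 2 * d (lift ord0 i))%N%:R - alpha
      - (- z ord0)%:~R = - \sum_j (x j - (z j)%:~R) * th j.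
  under [in RHS]eq_bigr do rewrite mulrBl.
  rewrite sumrB xE opprB [in RHS]big_ord_recl th0 mulr1 rmorphN/= opprK.
  rewrite addrC addrA; congr (_ + _ - _); apply: eq_bigr => i _.
  have [z1 _] := zb i.
  rewrite natrM sqrtrM// natrX sqrtr_sqr ger0_norm//; congr (_ * _).
  by rewrite natr_absz ger0_norm// (le_trans _ z1).
by rewrite normrN natrM -mulrA.
Qed.

Lemma nth0_radicands m : nth 0%N (radicands m) 0 = 1%N.
Proof. by elim: m => //= m IHm; rewrite nth_cat size_radicands expn_gt0. Qed.

(** Every radicand divides the product of the first m Fermat numbers, 2^2^m - 1, whence the bound M
    = 2^(K + 1). *)
Lemma radicands_approx (R : realType) (m K C : nat) (alpha : R) :
  (2 ^ m)%N = K.+1 -> (0 < K)%N -> (0 < C)%N ->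
  exists b : 'I_K -> nat,
    (forall i, 1 <= b i <= 9 * K.+1 ^ 6 * (2 ^ K.+1) ^ 5 * C ^ 2)%N /\
    dist_int (\sum_i Num.sqrt (b i)%:R - alpha) <=
      (K.+1 * 2 ^ K.+1)%:R / C%:R ^+ K.
Proof.
move=> mK K0 C0.
have rad (i : 'I_K.+1) : nth 0%N (radicands m) i \in radicands m.
  by rewrite mem_nth// size_radicands mK.
apply: (sqrt_basis_approx R K (2 ^ K.+1) C
  (fun i => nth 0%N (radicands m) i)) => //.
- exact: nth0_radicands.
- move=> i; have /andP[-> h] := radicands_bounds m _ (rad i).
  by rewrite (leq_trans h)// -mK -fermat_prodE.
- move=> i j; have [z [g [/(nthP 0%N)[l lm <-] e]]] :=
    radicands_mul m _ _ (rad i) (rad j).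
  move: lm; rewrite size_radicands mK => lm.
  by exists (Ordinal lm), g.
move=> c c0 i.
have := sqrt_radicands_free R m (fun n => c (inord n)).
rewrite mK => /(_ _ i (ltn_ord i)); rewrite inord_val; apply.
by rewrite -[RHS]c0; apply: eq_bigr => j _; rewrite inord_val.
Qed.

(** * Constants and the exponent *)

(** The largest C with L C^2 <= n works, as (C + 1)^2 <= 4 C^2 for C >= 1. *)
Lemma quadratic_scale (L n : nat) : (0 < L <= n)%N ->
  exists C, (0 < C)%N && (L * C ^ 2 <= n < 4 * (L * C ^ 2))%N.
Proof.
move=> /andP[L0 Ln].
have P1 : exists C, (L * C ^ 2 <= n)%N by exists 1%N; rewrite muln1.
have Pn C : (L * C ^ 2 <= n)%N -> (C <= n)%N.
  by rewrite -mulnn; nia.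
have [C CL Cmax] := ex_maxnP P1 Pn.
have C0 : (0 < C)%N by apply: Cmax; rewrite muln1.
exists C; rewrite C0 CL /=.
have : (n < L * C.+1 ^ 2)%N.
  by rewrite ltnNge; apply/negP => /Cmax; rewrite ltnn.
by move=> h; apply: leq_trans h _; rewrite -!mulnn; nia.
Qed.

(** The left side is the error factor of [radicands_approx] times the loss (4 L)^K in passing from C
    to sqrt n, where L is the factor of C^2 in its size bound. *)
Lemma constant_bound (K k : nat) : (K <= k)%N ->
  (K.+1 * 2 ^ K.+1 * (4 * (9 * K.+1 ^ 6 * (2 ^ K.+1) ^ 5)) ^ K <=
   2 ^ (19 * (k.+1 * k.+1)))%N.
Proof.
move=> Kk; set N := K.+1.
have NM : (N <= 2 ^ N)%N by rewrite ltnW// ltn_expl.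
apply: (@leq_trans (2 ^ N * 2 ^ N * (2 ^ 6 * (2 ^ N) ^ 11) ^ N)).
  apply: leq_mul; first by rewrite leq_mul.
  apply: (@leq_trans ((2 ^ 6 * (2 ^ N) ^ 11) ^ K)%N); last first.
    by rewrite leq_pexp2l// muln_gt0 !expn_gt0.
  have [->|K0] := posnP K; first by rewrite !expn0.
  rewrite leq_exp2r// [(4 * _)%N]mulnA [(4 * _)%N]mulnA.
  rewrite -[11%N]/(6 + 5)%N expnD [(2 ^ 6 * _)%N]mulnA leq_mul// leq_mul//.
  by rewrite leq_exp2r.
(* The exponent is 2 N + (6 + 11 N) N = 11 N^2 + 8 N <= 19 N^2. *)
rewrite -!expnM -!expnD -expnM -expnD leq_pexp2l// /N.
by nia.
Qed.

(** With K = 2^m - 1 this is K / 2, so n^-gamma is (sqrt n)^-K, matching the error C^-K. *)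
Lemma gammaE (R : realType) (k : nat) : (0 < k)%N ->
  gamma R k = ((2 ^ trunc_log 2 k.+1)%:R - 1) / 2.
Proof.
move=> k0; set m := trunc_log 2 k.+1.
have /andP[mk km] : (2 ^ m <= k.+1 < 2 ^ m.+1)%N by exact: trunc_log_bounds.
have ln20 : 0 < ln 2 :> R by rewrite ln_gt0// ltr1n.
have lnX j : ln (2 ^ j)%:R = j%:R * ln 2 :> R by rewrite natrX lnXn// mulr_natl.
have -> : gamma R k = 2 ^ (m%:Z - 1) - 2^-1.
  rewrite /gamma; congr (2 ^ (_ - 1) - _); apply: floor_def.
  rewrite ler_pdivlMr// ltr_pdivrMr// -[m%:~R]/(m%:R) -lnX.
  rewrite ler_ln ?posrE ?ltr0n ?expn_gt0// ler_nat mk /=.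
  have -> : (m%:Z + 1)%:~R = m.+1%:R :> R by rewrite intrD -natr1.
  by rewrite -lnX ltr_ln ?posrE ?ltr0n ?expn_gt0// ltr_nat.
have m0 : (0 < m)%N by rewrite trunc_log_gt0.
rewrite -(prednK m0).
have -> : m.-1.+1%:Z - 1 = m.-1%:Z by rewrite -addn1 PoszD addrK.
by rewrite -exprnP expnS natrM natrX; field.
Qed.

Lemma gamma_ge (R : realType) (k : nat) : (0 < k)%N ->
  (k%:R - 1) / 4 <= gamma R k.
Proof.
move=> k0; rewrite gammaE//.
have := trunc_log_ltn k.+1 (isT : 1 < 2)%N; rewrite expnS.
move: (2 ^ _)%N => N; rewrite -(ltr_nat R) natrM -natr1 => h.
lra.
Qed.

(** * Padding to k summands and the final estimate *)

Lemma dist_int_le1 (R : realType) (x : R) : dist_int x <= 1.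
Proof.
apply: le_trans (dist_int_le x (Num.floor x)) _.
have := floor_le x; have := floorD1_gt x.
by rewrite intrD ler_norml; lra.
Qed.

(** Serves to add the k - K surplus summands, each equal to sqrt 1. *)
Lemma dist_int_addn (R : realType) (x : R) (n : nat) :
  dist_int (x + n%:R) <= dist_int x.
Proof.
have [m ->] := dist_int_attained x.
apply: le_trans (dist_int_le _ (m + n%:Z)) _.
by rewrite intrD opprD addrACA subrr addr0.
Qed.

Theorem theorem1p2 (R : realType) :
  exists2 D : nat -> R, effective D &
    forall k : nat, (1 <= k)%N ->
      [/\ 0 < D k,
          (forall (alpha : R) (n : nat), (1 <= n)%N ->
             exists b : 'I_k -> nat,
               (forall j : 'I_k, (1 <= b j <= n)%N) /\
               dist_int (\sum_(j < k) Num.sqrt (b j)%:R - alpha)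
                 <= D k * n%:R `^ (- gamma R k)) &
          (k%:R - 1) / 4 <= gamma R k].
Proof.
exists (fun k => (2 ^ (19 * (k.+1 * k.+1)))%:R).
  apply: effective_natr; apply: (recursive_exp _ (fun=> 2%N)); last first.
    exact: recursive_const.
  apply: recursive_mul; first exact: recursive_const.
  have rS := recursive_comp1 S _ rec_succ (rec_proj 0).
  exact: recursive_mul.
move=> k k0; split; [by rewrite ltr0n expn_gt0 | | exact: gamma_ge].
move=> alpha n n0.
(* K is the largest number of the form 2^m - 1 that is at most k; only K of the summands do the
   approximating. *)
set m := trunc_log 2 k.+1; pose K := (2 ^ m).-1.
have mK : (2 ^ m)%N = K.+1 by rewrite prednK// expn_gt0.
have Kk : (K <= k)%N by rewrite -ltnS -mK trunc_logP.
have K0 : (0 < K)%N.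
  suff : (1 < K.+1)%N by [].
  by rewrite -mK -[1%N](expn0 2) ltn_exp2l// trunc_log_gt0.
have -> : n%:R `^ (- gamma R k) = (Num.sqrt n%:R ^+ K)^-1 :> R.
  rewrite gammaE// mK -natr1 addrK powRN mulrC powRrM powR12_sqrt//.
  by rewrite powR_mulrn// sqrtr_ge0.
have sn0 : 0 < Num.sqrt n%:R :> R by rewrite sqrtr_gt0 ltr0n.
have sqrt_le (a : nat) : (n <= a ^ 2)%N -> Num.sqrt n%:R <= a%:R :> R.
  move=> h; rewrite -(ler_pXn2r (n := 2))// ?nnegrE ?sqrtr_ge0// sqr_sqrtr//.
  by rewrite -natrX ler_nat.
have := constant_bound K k Kk; set Dk := (2 ^ (19 * _))%N.
pose L := (9 * K.+1 ^ 6 * (2 ^ K.+1) ^ 5)%N; rewrite -/L => Dkb.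
have L0 : (0 < L)%N by rewrite !muln_gt0 !expn_gt0.
have sK0 : 0 < Num.sqrt n%:R ^+ K :> R by rewrite exprn_gt0.
(* For n < L the bound is trivial: the distance is at most 1, and (sqrt n)^K <= (4 L)^K <= [Dk]. *)
have [nL|Ln] := ltnP n L.
  exists (fun=> 1%N); split=> //; rewrite ler_pdivlMr//.
  apply: (@le_trans _ _ (1 * (4 * L)%:R ^+ K)).
    apply: ler_pM; rewrite ?exprn_ge0 ?sqrtr_ge0//.
    - by have [j ->] := dist_int_attained (\sum_(j < k) Num.sqrt 1%:R - alpha).
    - exact: dist_int_le1.
    rewrite lerXn2r ?nnegrE ?sqrtr_ge0//; apply: sqrt_le.
    by rewrite -mulnn; nia.
  rewrite mul1r -natrX ler_nat; apply: leq_trans Dkb.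
  by rewrite leq_pmull// muln_gt0 expn_gt0.
have [C /and3P[C0 CL nC]] := quadratic_scale L n (introT andP (conj L0 Ln)).
have [b [bn bd]] := radicands_approx R m K C alpha mK K0 C0.
(* The default 1 keeps the extra entries in range and makes their square roots integers. *)
pose b' j := if insub j is Some i then b i else 1%N.
have b'E (i : 'I_K) : b' i = b i by rewrite /b' valK.
exists b'; split.
  move=> j; rewrite /b'; case: insubP => [i _ _|_]; last by rewrite n0.
  by have /andP[-> h] := bn i; rewrite (leq_trans h).
rewrite ler_pdivlMr//; have -> : \sum_(j < k) Num.sqrt (b' j)%:R - alpha =
    (\sum_i Num.sqrt (b i)%:R - alpha) + (k - K)%:R.
  rewrite -(big_mkord xpredT (fun j => Num.sqrt (b' j)%:R))
    (@big_cat_nat _ _ _ K)//=.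
  rewrite addrAC big_mkord; congr (_ - _ + _).
    by apply: eq_bigr => i _; rewrite b'E.
  rewrite (eq_big_nat _ _ (F2 := fun=> 1)) => [|j /andP[Kj _]].
    by rewrite sumr_const_nat.
  by rewrite /b' insubF ?sqrtr1// ltnNge Kj.
(* From n < 4 L C^2 follows sqrt n <= 4 L C, after which the powers of C cancel. *)
apply: (@le_trans _ _ ((K.+1 * 2 ^ K.+1)%:R / C%:R ^+ K * (4 * L * C)%:R ^+ K)).
  apply: ler_pM; rewrite ?exprn_ge0 ?sqrtr_ge0//.
  - by have [j ->] := dist_int_attained
      (\sum_i Num.sqrt (b i)%:R - alpha + (k - K)%:R).
  - exact: le_trans (dist_int_addn _ _ _) bd.
  rewrite lerXn2r ?nnegrE ?sqrtr_ge0//; apply: sqrt_le.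
  by rewrite -mulnn; move: nC; rewrite -mulnn; nia.
rewrite [(4 * L * C)%:R]natrM exprMn mulrCA divrK ?unitfE ?expf_neq0 ?pnatr_eq0
  -?lt0n//.
by rewrite -natrX -natrM ler_nat mulnC.
Qed.
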